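(* Let $A \in L(\mathcal{H})$ have closed range and let $W \in L(\mathcal{H})^{+}$. For $X\in L(\mathcal{H})$ put $F(X)=(AX-I)^{*}W(AX-I)$. Then the set $\{F(X): X\in L(\mathcal{H})\}$ has a minimum with respect to the operator order, i.e., there exists $X_0\in L(\mathcal{H})$ such that $$F(X_0)=\min_{X \in L(\mathcal{H})}F(X)=W_{/R(A)},$$ if and only if the pair $(W, R(A))$ is compatible.
   Context: $\mathcal{H}$ is a separable complex Hilbert space, $L(\mathcal{H})$ is the algebra of bounded linear operators on $\mathcal{H}$, $L(\mathcal{H})^{+}$ is the cone of positive semidefinite operators, $I$ is the identity operator, and $R(T)$ denotes the range of $T$. The operator order is: $S\le T$ if $T-S\in L(\mathcal{H})^{+}$. For $W\in L(\mathcal{H})^{+}$ and a closed subspace $\mathcal{S}\subseteq\mathcal{H}$, the shorted operator of $W$ to $\mathcal{S}$ is $W_{/\mathcal{S}}=\max\{X\in L(\mathcal{H}): 0\le X\le W \text{ and } R(X)\subseteq \mathcal{S}^{\perp}\}$; this maximum (in the operator order) is known to exist. The pair $(W,\mathcal{S})$ is compatible if there exists $Q\in L(\mathcal{H})$ with $Q^2=Q$, $R(Q)=\mathcal{S}$ and $WQ=Q^{*}W$. *)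

(* Defs.v *)
From HB Require Import structures.
From mathcomp Require Import all_boot all_order all_algebra.
From mathcomp Require Import complex.
From mathcomp Require Import all_classical all_reals all_analysis.

Set Implicit Arguments.
Unset Strict Implicit.
Unset Printing Implicit Defensive.

Import Order.TTheory GRing.Theory Num.Theory.
Import numFieldNormedType.Exports.

Local Open Scope classical_set_scope.
Local Open Scope ring_scope.

(* Complex Hilbert spaces over R[i], linear in the first argument of [hdot] and
   conjugate linear in the second. The field [hdot_normE] ties the inner product
   to the norm with respect to which the space is complete. *)
HB.mixin Record CompleteNormedModule_isHilbert (R : realType) H
    of CompleteNormedModule R[i] H := {
  hdot : {dot H for Num.conj} ;
  hdot_normE : forall x : H, `|x| ^+ 2 = hdot x x
}.

#[short(type="hilbertType")]
HB.structure Definition Hilbert (R : realType) :=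
  {H of CompleteNormedModule R[i] H & CompleteNormedModule_isHilbert R H}.

Definition separable (T : topologicalType) : Prop :=
  exists2 D : set T, countable D & dense D.

Section Operators.
Variables (R : realType) (H : hilbertType R).
Implicit Types (S T W X Q : H -> H) (V : set H) (E : set (H -> H)).

(* The algebra L(H). *)
Definition bounded_op : set (H -> H) :=
  [set T | linear T /\ exists M : R, forall x, `|T x| <= M%:C%C * `|x|].

(* The value 0 is never used on L(H): a bounded operator on a Hilbert space has
   exactly one adjoint, by the Riesz representation theorem. *)
Definition adjoint T : H -> H :=
  xget (0 : H -> H)
    [set S | bounded_op S /\ forall x y, hdot (T x) y = hdot x (S y)].

(* In R[i], [0 <= z] says that z is real and nonnegative. *)
Definition positive_op : set (H -> H) :=
  [set T | bounded_op T /\ forall x, 0 <= hdot (T x) x].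

Definition op_le S T : Prop := positive_op (T - S).

Definition is_op_min E S : Prop := E S /\ forall T, E T -> op_le S T.

Definition is_op_max E S : Prop := E S /\ forall T, E T -> op_le T S.

Definition orthocomp V : set H := [set y | forall x, V x -> hdot x y = 0].

(* [is_shorted W V Z] says that Z is the shorted operator of W to V; such a Z is
   unique because [op_le] is antisymmetric on L(H). *)
Definition is_shorted W V : (H -> H) -> Prop :=
  is_op_max [set X | [/\ bounded_op X, op_le 0 X, op_le X W
                       & range X `<=` orthocomp V]].

Definition compatible W V : Prop :=
  exists Q, [/\ bounded_op Q, Q \o Q = Q, range Q = V
              & W \o Q = adjoint Q \o W].

Definition residual_form A W X : H -> H :=
  adjoint (A \o X - id) \o W \o (A \o X - id).

End Operators.

(* Main.v *)
From HB Require Import structures.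
Require Import Defs.
From mathcomp Require Import all_boot all_order all_algebra complex.
From mathcomp Require Import all_classical all_reals all_analysis.
From mathcomp Require Import ring lra zify.

(** Suppose first that [Q] is a bounded projection onto the range of [A] with
    [W Q = Q^* W], and that [A X0 = Q]. For every [X] the operator
    [A X - I] is the sum of [Q - I] and of an operator with values in the range
    of [A], and the two parts are orthogonal for the semi-inner product
    [<W x, y>], because [Q^* W (Q - I) = W Q (Q - I) = 0]. By Pythagoras
    [F X >= F X0]. The form [F X0 = (Q - I)^* W (Q - I)] is positive, below [W]
    (Pythagoras again, for [- I] in place of [A X - I]), and its range is
    orthogonal to that of [A]; any other such operator [Z] kills the range of
    [A] on both sides, so [Z = (Q - I)^* Z (Q - I) <= (Q - I)^* W (Q - I)].
    This is [compatible_is_op_min].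

    A bounded solution [X0] of [A X0 = Q] exists by Douglas' factorization
    theorem [bounded_op_factor]: the linear solution with values orthogonal to
    the kernel of [A] is automatically bounded, by the uniform boundedness
    principle [uniform_boundedness].

    Conversely, let [F X0] be a minimum. Comparing [F X0] with
    [F (X0 + t a I)] for real [t] and complex [a] shows that the first order
    term vanishes, and polarization turns this into: every [A X0 x - x] is
    [W]-orthogonal to the range of [A] ([op_min_weight_orthogonal]). So
    [A X0 x] is a [W]-orthogonal projection of [x] to the range, except that
    [A X0] need not fix the range pointwise. With [P] the orthogonal projection
    onto the (closed) range, [Q = P + A X0 (I - P)] does, and it is still
    [W]-orthogonal, which is the compatibility condition
    ([op_min_compatible]).

    Nearly all of the analysis uses only the real inner product
    [rdot x y = Re <x, y>], which makes order arguments take place in the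
    totally ordered field [R]; a complex subspace has the same orthogonal
    complement for [rdot] as for [hdot]. *)

Set Implicit Arguments.
Unset Strict Implicit.
Unset Printing Implicit Defensive.

Import Order.TTheory GRing.Theory Num.Theory.
Import numFieldNormedType.Exports.

Local Open Scope classical_set_scope.
Local Open Scope ring_scope.
Local Open Scope complex_scope.

(** * The underlying real inner product space *)

(** Locked, like [nrm] below, so that the arithmetic decision procedures treat
    its values as atoms. *)
HB.lock
Definition rdot (R : realType) (H : hilbertType R) (x y : H) : R :=
  complex.Re (hdot x y).

HB.lock
Definition nrm (R : realType) (H : hilbertType R) (x : H) : R :=
  complex.Re `|x|.

Section RealInnerProduct.
Variables (R : realType) (H : hilbertType R).
Implicit Types (x y z w : H) (t : R).

Lemma rdotDl x y z : rdot (x + y) z = rdot x z + rdot y z.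
Proof. by rewrite rdot.unlock linearDl; exact: raddfD. Qed.

Lemma rdotNl x y : rdot (- x) y = - rdot x y.
Proof. by rewrite rdot.unlock linearNl; exact: raddfN. Qed.

Lemma rdotZl t x y : rdot (t%:C *: x) y = t * rdot x y.
Proof.
have ReZ (z : R[i]) : complex.Re (t%:C * z) = t * complex.Re z.
  by case: z => a b /=; rewrite mul0r subr0.
by rewrite rdot.unlock linearZl_LR; exact: ReZ.
Qed.

Lemma hdotC x y : hdot x y = (hdot y x)^*%C.
Proof. by rewrite hermC expr0 mul1r. Qed.

Lemma hdotZr (a : R[i]) x y : hdot x (a *: y) = a^*%C * hdot x y.
Proof. by rewrite linearZr_LR. Qed.

Lemma rdotC x y : rdot x y = rdot y x.
Proof. by rewrite rdot.unlock hdotC; case: (hdot y x). Qed.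

Lemma rdotDr x y z : rdot z (x + y) = rdot z x + rdot z y.
Proof. by rewrite rdotC rdotDl !(rdotC z). Qed.

Lemma rdotNr x y : rdot x (- y) = - rdot x y.
Proof. by rewrite rdotC rdotNl rdotC. Qed.

Lemma rdotZr t x y : rdot x (t%:C *: y) = t * rdot x y.
Proof. by rewrite rdotC rdotZl rdotC. Qed.

Lemma rdotBl x y z : rdot (x - y) z = rdot x z - rdot y z.
Proof. by rewrite rdotDl rdotNl. Qed.

Lemma rdotBr x y z : rdot z (x - y) = rdot z x - rdot z y.
Proof. by rewrite rdotDr rdotNr. Qed.

Lemma rdot0l x : rdot 0 x = 0.
Proof. by rewrite -(subrr x) rdotBl subrr. Qed.

Lemma rdot0r x : rdot x 0 = 0.
Proof. by rewrite rdotC rdot0l. Qed.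

(** A complex inner product is determined by its real part; this transfers
    identities from [rdot] back to [hdot]. *)
Lemma hdotE x y : hdot x y = rdot x y +i* rdot x ('i *: y).
Proof.
rewrite rdot.unlock hdotZr; case: (hdot x y) => a b /=.
by congr (_ +i* _); ring.
Qed.

Lemma rdot_i x y : rdot ('i *: x) ('i *: y) = rdot x y.
Proof.
rewrite rdot.unlock hdotZr hdotC hdotZr (hdotC y).
by case: (hdot x y) => a b /=; ring.
Qed.

Lemma rdot_conjZ (a : R[i]) x y : rdot x (a *: y) = rdot (a^*%C *: x) y.
Proof. by rewrite rdot.unlock hdotZr linearZl_LR. Qed.

Lemma hdot_rdot_eq x y z w : hdot x y = hdot z w -> rdot x y = rdot z w.
Proof. by rewrite rdot.unlock => ->. Qed.

Lemma normE x : `|x| = (nrm x)%:C.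
Proof. by rewrite nrm.unlock RRe_real // normr_real. Qed.

Lemma nrm_ge0 x : 0 <= nrm x.
Proof. by rewrite -ler0c -normE. Qed.

Lemma rdotxx x : rdot x x = nrm x ^+ 2.
Proof. by rewrite rdot.unlock -hdot_normE normE -rmorphXn. Qed.

Lemma nrmD x y : nrm (x + y) <= nrm x + nrm y.
Proof. by rewrite -lecR rmorphD /= -!normE ler_normD. Qed.

Lemma nrmN x : nrm (- x) = nrm x.
Proof. by rewrite nrm.unlock normrN. Qed.

Lemma nrmBC x y : nrm (x - y) = nrm (y - x).
Proof. by rewrite -nrmN opprB. Qed.

Lemma nrmB x y : nrm x - nrm y <= nrm (x - y).
Proof. by rewrite lerBlDr -{1}(subrK y x) nrmD. Qed.

Lemma nrmZ t x : nrm (t%:C *: x) = `|t| * nrm x.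
Proof.
apply: complexI; rewrite -normE normrZ normE rmorphM /=.
by rewrite normc_def /= expr0n addr0 sqrtr_sqr.
Qed.

Lemma nrm_eq0 x : nrm x = 0 -> x = 0.
Proof. by move=> x0; apply/normr0_eq0; rewrite normE x0. Qed.

Lemma nrm0 : nrm (0 : H) = 0.
Proof. by rewrite nrm.unlock normr0. Qed.

Lemma rdotxx_eq0 x : rdot x x = 0 -> x = 0.
Proof. by rewrite rdotxx => /eqP; rewrite sqrf_eq0 => /eqP/nrm_eq0. Qed.

(** Cauchy-Schwarz, read off from the triangle inequality for the given norm. *)
Lemma rdot_le_nrm x y : rdot x y <= nrm x * nrm y.
Proof.
have := nrmD x y; rewrite -(ler_pXn2r (n := 2)) ?nnegrE ?addr_ge0 ?nrm_ge0 //.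
rewrite -rdotxx rdotDl !rdotDr !rdotxx (rdotC y x).
set a := nrm x; set b := nrm y; set c := rdot x y; nra.
Qed.

(** Completeness restated with the real norm and real tolerances. *)
Lemma hilbert_complete (u : nat -> H) :
  (forall e : R, 0 < e ->
     exists N, forall m n, (N <= m)%N -> (N <= n)%N -> nrm (u m - u n) <= e) ->
  exists l, forall e : R, 0 < e ->
     exists N, forall n, (N <= n)%N -> nrm (l - u n) <= e.
Proof.
move=> u_cauchy.
have Re_gt0 (e : R[i]) : 0 < e -> 0 < complex.Re e /\ e = (complex.Re e)%:C.
  move=> e0; have eE : e = (complex.Re e)%:C by rewrite RRe_real // gtr0_real.
  by split=> //; rewrite -ltcR -eE.
have /cauchy_cvgP u_cvg : cauchy (u @ \oo).
  apply/cauchy_ballP => e /Re_gt0[e0 ->].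
  have [|N uN] := u_cauchy (complex.Re e / 2); first by rewrite divr_gt0.
  exists (u @` [set n | (N <= n)%N], u @` [set n | (N <= n)%N]) => /=.
    by split; exists N => // n Nn; exists n.
  move=> [_ _] /= [[m Nm <-] [n Nn <-]]; rewrite -ball_normE /= normE ltcR.
  by apply: le_lt_trans (uN _ _ Nm Nn) _; lra.
exists (lim (u @ \oo)) => e e0.
have e0C : 0 < e%:C by rewrite ltcR.
move/cvgrPdist_le: u_cvg => /(_ _ e0C) [N _ uN].
by exists N => n Nn; rewrite -lecR -normE; exact: uN.
Qed.

End RealInnerProduct.

(** * Orthogonal projection *)

(** First order optimality: near [t = 0] the linear term dominates, so it can only
    be nonnegative for both signs of [t] if its coefficient vanishes. *)
Lemma quadratic_ge0_linear_eq0 (R : realFieldType) (a b : R) :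
  (forall t, 0 <= t * b *+ 2 + t ^+ 2 * a) -> b = 0.
Proof.
move=> q_ge0; pose s := (1 + `|a|)^-1.
have a1 : 0 < 1 + `|a| by rewrite ltr_pwDl.
have s0 : 0 < s by rewrite invr_gt0.
have sa : s * a <= 1.
  rewrite mulrC ler_pdivrMr // mul1r.
  by rewrite (le_trans (ler_norm a)) // lerDr.
apply/eqP; rewrite -sqrf_eq0 eq_le sqr_ge0 andbT.
rewrite -(pmulr_lle0 _ s0).
(* The step length [s] is small enough that the quadratic term cancels at most
   half of the linear one. *)
have := q_ge0 (- (b * s)).
have : 0 <= b ^+ 2 * s * (1 - s * a).
  by rewrite mulr_ge0 ?subr_ge0 // mulr_ge0 ?sqr_ge0 // ltW.
nra.
Qed.

Lemma exists_natSinv_le (R : archiRealFieldType) (e : R) :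
  0 < e -> exists N, forall n, (N <= n)%N -> n.+1%:R^-1 <= e.
Proof.
move=> e0; exists (Num.truncn e^-1) => n Nn.
rewrite -[leRHS]invrK lef_pV2 ?posrE ?invr_gt0 ?ltr0n //.
rewrite (le_trans (ltW (truncnS_gt _))) // ler_nat ltnS //.
Qed.

Section Projection.
Variables (R : realType) (H : hilbertType R).
Implicit Types (x y z : H) (t : R) (V : set H).

Definition real_subspace V :=
  V 0 /\ forall x y t, V x -> V y -> V (x + t%:C *: y).

Lemma closure_nrmP V x :
  closure V x <-> forall e : R, 0 < e -> exists2 v, V v & nrm (x - v) <= e.
Proof.
split=> [Vx e e0 | Vx B /nbhs_ballP[e /= e0 eB]].
  have [|v [Vv]] := Vx (ball x e%:C).
    by apply: nbhsx_ballx; rewrite ltcR.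
  by rewrite -ball_normE /= normE ltcR => /ltW; exists v.
have eE : e = (complex.Re e)%:C by rewrite RRe_real // gtr0_real.
have e1 : 0 < complex.Re e by rewrite -ltcR -eE.
have [|v Vv xv] := Vx (complex.Re e / 2); first by rewrite divr_gt0.
exists v; split=> //; apply: eB; rewrite -ball_normE /= normE eE ltcR.
by apply: le_lt_trans xv _; lra.
Qed.

Lemma parallelogram x y :
  nrm (x - y) ^+ 2 = nrm x ^+ 2 *+ 2 + nrm y ^+ 2 *+ 2 - nrm (x + y) ^+ 2.
Proof. by rewrite -!rdotxx !(rdotBl, rdotBr, rdotDl, rdotDr); ring. Qed.

(** A minimizing sequence for the distance from [x] to [V] is Cauchy by the
    parallelogram identity, and at its limit [p] the first order condition is
    the orthogonality of [x - p] to [V]. The limit is only claimed to be in the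
    closure, so that the lemma also yields density results. *)
Lemma orthogonal_projection V x : real_subspace V ->
  exists2 p, closure V p & forall v, V v -> rdot (x - p) v = 0.
Proof.
move=> [V0 VD]; pose E := [set nrm (x - v) | v in V]; pose d := inf E.
have E_lb : lbound E 0 by move=> _ [v _ <-]; exact: nrm_ge0.
have E_inf : has_inf E by split; [exists (nrm (x - 0)), 0 | exists 0].
have d_le v : V v -> d <= nrm (x - v).
  by move=> Vv; apply: ge_inf; [exists 0 | exists v].
have d_ge0 : 0 <= d by apply: lb_le_inf => //; case: E_inf.
have /choice[v v_min] n :
    exists v, V v /\ nrm (x - v) <= d + n.+1%:R^-1.
  have [|_ [v Vv <-] /ltW] := inf_adherent (eps := n.+1%:R^-1) _ E_inf.
    by rewrite invr_gt0.
  by exists v.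
have v_near (e : R) : 0 < e ->
    exists N, forall n, (N <= n)%N -> nrm (x - v n) <= d + e.
  move=> /exists_natSinv_le[N Ne]; exists N => n /Ne ne.
  by apply: le_trans (v_min n).2 _; rewrite lerD2l.
have [|p vp] := hilbert_complete (u := v).
  move=> e e0; have d1 : 0 < 8 * d + 4 by lra.
  (* If both distances are at most [d + eta] then the squared distance of the two
     points is at most [4 (d + eta)^2 - 4 d^2 = 8 d eta + 4 eta^2]. *)
  pose eta := Num.min 1 (e ^+ 2 / (8 * d + 4)).
  have eta0 : 0 < eta by rewrite lt_min ltr01 divr_gt0 // exprn_gt0.
  have eta1 : eta <= 1 by rewrite ge_min lexx.
  have eta2 : eta * (8 * d + 4) <= e ^+ 2.
    by rewrite -ler_pdivlMr // ge_min lexx orbT.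
  have [N vN] := v_near _ eta0; exists N => m n /vN mN /vN nN.
  rewrite -(ler_pXn2r (n := 2)) ?nnegrE ?nrm_ge0 ?(ltW e0) //.
  rewrite (_ : v m - v n = (x - v n) - (x - v m)); last first.
    by rewrite opprB [RHS]addrC subrKA.
  rewrite parallelogram.
  have /d_le mid : V (0 + (2^-1)%:C *: (v m + (1:R)%:C *: v n)).
    by apply: (VD) => //; apply: VD; [exact: (v_min m).1 | exact: (v_min n).1].
  have : d * 2 <= nrm ((x - v n) + (x - v m)).
    rewrite (_ : _ + _ = (2 : R)%:C *:
        (x - (0 + (2^-1)%:C *: (v m + (1:R)%:C *: v n)))); last first.
      rewrite scalerBr add0r scalerA -rmorphM /= divff ?pnatr_eq0 //.
      rewrite !scale1r rmorphD /= scalerDl scale1r opprD addrACA.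
      by rewrite (addrC (- v n)).
    by rewrite nrmZ ger0_norm // mulrC ler_pM2l.
  move: mN nN eta0 eta1 eta2 d_ge0.
  move: (nrm_ge0 (x - v m)) (nrm_ge0 (x - v n)).
  set A := nrm (x - v m); set B := nrm (x - v n); set C := nrm _.
  move=> A0 B0 Ad Bd eta0 eta1 eta2 d0 dC.
  have A2 : A ^+ 2 <= (d + eta) ^+ 2 by rewrite ler_pXn2r ?nnegrE //; lra.
  have B2 : B ^+ 2 <= (d + eta) ^+ 2 by rewrite ler_pXn2r ?nnegrE //; lra.
  have C2 : (d * 2) ^+ 2 <= C ^+ 2 by rewrite ler_pXn2r ?nnegrE //; lra.
  nra.
have near_p (e : R) : 0 < e ->
    exists2 w, V w & nrm (p - w) <= e /\ nrm (x - w) <= d + e.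
  move=> e0; have [[N1 H1] [N2 H2]] := (vp _ e0, v_near _ e0).
  exists (v (maxn N1 N2)); first exact: (v_min _).1.
  by split; [apply: H1; rewrite leq_maxl | apply: H2; rewrite leq_maxr].
exists p.
  by apply/closure_nrmP => e /near_p[w Vw [pw _]]; exists w.
have xp : nrm (x - p) <= d.
  apply/ler_addgt0Pr => e e0.
  have [|w _ [pw xw]] := near_p (e / 2); first by rewrite divr_gt0.
  have := nrmD (x - w) (w - p); rewrite subrKA => /le_trans; apply.
  by rewrite (nrmBC w); lra.
move=> w Vw; apply: (@quadratic_ge0_linear_eq0 _ (rdot w w)) => t.
have : d <= nrm (x - p + t%:C *: w).
  apply/ler_addgt0Pr => e e0; have [q Vq [pq _]] := near_p _ e0.
  have /d_le/le_trans : V (q + (- t)%:C *: w) by exact: VD.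
  apply.
  rewrite (_ : x - _ = (x - p + t%:C *: w) + (p - q)).
    by apply: le_trans (nrmD _ _) _; rewrite lerD2l.
  by rewrite rmorphN scaleNr opprD opprK addrA [RHS]addrAC subrKA.
move=> /(le_trans xp).
rewrite -(ler_pXn2r (n := 2)) ?nnegrE ?nrm_ge0 // -!rdotxx.
rewrite (rdotDl (x - p)) !(rdotDr (x - p)) !rdotZl !rdotZr (rdotC w).
by move=> ?; lra.
Qed.

End Projection.

(** * Bounded operators and their adjoints *)

Section Operators.
Variables (R : realType) (H : hilbertType R).
Implicit Types (x y z : H) (t : R) (S T P : H -> H) (s : H).

Section Linear.
Variable (T : H -> H) (LT : linear T).

Lemma lin0 : T 0 = 0.
Proof. by have := LT (-1) 0 0; rewrite !scaleN1r oppr0 addr0 addNr. Qed.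

Lemma linD x y : T (x + y) = T x + T y.
Proof. by have := LT 1 x y; rewrite !scale1r. Qed.

Lemma linZ (a : R[i]) x : T (a *: x) = a *: T x.
Proof. by have := LT a x 0; rewrite lin0 !addr0. Qed.

Lemma linN x : T (- x) = - T x.
Proof. by rewrite -scaleN1r linZ scaleN1r. Qed.

Lemma linB x y : T (x - y) = T x - T y.
Proof. by rewrite linD linN. Qed.

Lemma linear_range_subspace : real_subspace (range T).
Proof.
split; first by exists 0; rewrite ?lin0.
by move=> _ _ t [x _ <-] [y _ <-]; exists (x + t%:C *: y); rewrite // linD linZ.
Qed.

End Linear.

Lemma rdot_inj y z : (forall x, rdot x y = rdot x z) -> y = z.
Proof.
by move=> yz; apply/eqP; rewrite -subr_eq0; apply/eqP/rdotxx_eq0;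
  rewrite rdotBr yz subrr.
Qed.

Lemma hdot_linear_eq S T x y : linear S -> linear T ->
    (forall u v, rdot (T u) v = rdot u (S v)) ->
  hdot (T x) y = hdot x (S y).
Proof. by move=> LS LT TS; rewrite !hdotE -(linZ LS) -!TS. Qed.

Lemma bounded_opP T :
  bounded_op T <->
  linear T /\ exists2 M : R, 0 <= M & forall x, nrm (T x) <= M * nrm x.
Proof.
split=> [[LT [M TM]] | [LT [M _ TM]]]; split=> //.
  exists (Num.max 0 M) => [|x]; first by rewrite le_max lexx.
  have := TM x; rewrite !normE -rmorphM /= lecR => /le_trans; apply.
  by rewrite ler_wpM2r ?nrm_ge0 // le_max lexx orbT.
by exists M => x; rewrite !normE -rmorphM /= lecR.
Qed.

Lemma bounded_op_comp S T : bounded_op S -> bounded_op T -> bounded_op (S \o T).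
Proof.
move=> /bounded_opP[LS [M M0 SM]] /bounded_opP[LT [N N0 TN]].
apply/bounded_opP; split=> [a x y /= | ]; first by rewrite LT LS.
exists (M * N) => [|x /=]; first exact: mulr_ge0.
by apply: le_trans (SM _) _; rewrite -mulrA ler_wpM2l.
Qed.

Lemma bounded_opB S T : bounded_op S -> bounded_op T -> bounded_op (S - T).
Proof.
move=> /bounded_opP[LS [M M0 SM]] /bounded_opP[LT [N N0 TN]].
apply/bounded_opP; split=> [a x y | ].
  by rewrite !fctE LT LS scalerBr opprD addrACA.
exists (M + N) => [|x /=]; first exact: addr_ge0.
rewrite !fctE; apply: le_trans (nrmD _ _) _; rewrite nrmN mulrDl.
by apply: lerD.
Qed.

Lemma bounded_op_id : bounded_op (@id H).
Proof. by split=> //; exists 1 => x; rewrite mul1r. Qed.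

Lemma bounded_opZ (a : R[i]) : bounded_op (fun h : H => a *: h).
Proof.
split=> [b x y | ]; first by rewrite scalerDr !scalerA mulrC.
by exists (complex.Re `|a|) => x; rewrite normrZ RRe_real // normr_real.
Qed.

(** The representing vector is a multiple of the component, orthogonal to the
    kernel, of any vector outside the kernel. Only real linearity is asked: the
    complex version is recovered for adjoints from [rdot_conjZ]. *)
Lemma riesz_representation (f : H -> R) (M : R) :
    (forall x y t, f (x + t%:C *: y) = f x + t * f y) ->
    (forall x, f x <= M * nrm x) ->
  exists z, forall x, f x = rdot x z.
Proof.
move=> fD fM; pose K : set H := [set x | f x = 0].
have f0 : f 0 = 0.
  by have := fD 0 0 1; rewrite scaler0 addr0 => /eqP; rewrite -subr_eq0; lra.
have fZ t x : f (t%:C *: x) = t * f x by have := fD 0 x t; rewrite add0r f0 add0r.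
have fB x y : f (x - y) = f x - f y.
  have := fD x y (- 1).
  by rewrite rmorphN /= scaleN1r mulN1r.
have M1 : 0 < 1 + `|M| by rewrite ltr_pwDl.
have fM1 x : f x <= (1 + `|M|) * nrm x.
  apply: le_trans (fM x) _; rewrite ler_wpM2r ?nrm_ge0 //.
  by rewrite (le_trans (ler_norm M)) // lerDr.
have Ksub : real_subspace K.
  by split=> // x y t; rewrite /K /= fD => -> ->; rewrite mulr0 addr0.
have Kcl p : closure K p -> f p = 0.
  move=> /closure_nrmP Kp; apply/eqP; rewrite eq_le.
  apply/andP; split.
    apply/ler_addgt0Pr => e e0; have [|v vK pv] := Kp (e / (1 + `|M|)).
      by rewrite divr_gt0.
    rewrite add0r -[f p]subr0 -vK -fB (le_trans (fM1 _)) //.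
    by rewrite mulrC -ler_pdivlMr.
  apply/ler_addgt0Pr => e e0; have [|v vK pv] := Kp (e / (1 + `|M|)).
    by rewrite divr_gt0.
  rewrite -lerBlDl sub0r -[- f p]add0r -vK -fB (le_trans (fM1 _)) //.
  by rewrite nrmBC mulrC -ler_pdivlMr.
have [[x0 fx0]|f_eq0] := pselect (exists x, f x != 0); last first.
  exists 0 => x; rewrite rdot0r; apply: contrapT => /eqP fx.
  by apply: f_eq0; exists x.
have [p /Kcl fp pK] := orthogonal_projection x0 Ksub.
pose w := x0 - p; have fw : f w != 0 by rewrite fB fp subr0.
have ww : rdot w w != 0.
  by apply: contra fw => /eqP/rdotxx_eq0 ->; rewrite f0.
exists ((f w / rdot w w)%:C *: w) => x.
have : rdot w (x - (f x / f w)%:C *: w) = 0.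
  by apply: pK; rewrite /K /= fB fZ divfK // subrr.
rewrite rdotBr !rdotZr (rdotC w x) => /eqP; rewrite subr_eq0 => /eqP ->.
by field; rewrite fw ww.
Qed.

(** The adjoint is defined by choice with a default value; this is what justifies
    every later use of it. *)
Lemma adjoint_ex T : bounded_op T ->
  bounded_op (adjoint T) /\ forall x y, rdot (T x) y = rdot x (adjoint T y).
Proof.
move=> /bounded_opP[LT [M M0 TM]].
have /choice[S TS] y : exists z, forall x, rdot (T x) y = rdot x z.
  apply: (@riesz_representation _ (M * nrm y)) => [u v t | x].
    by rewrite (linD LT) (linZ LT) rdotDl rdotZl.
  apply: le_trans (rdot_le_nrm _ _) _.
  by rewrite mulrAC ler_wpM2r ?nrm_ge0.
have LS : linear S.
  move=> a y z; apply: rdot_inj => x.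
  by rewrite -TS !rdotDr !rdot_conjZ -!TS (linZ LT).
have BS : bounded_op S.
  apply/bounded_opP; split=> //; exists M => // y.
  have [-> | Sy] := eqVneq (nrm (S y)) 0; first by rewrite mulr_ge0 ?nrm_ge0.
  have Sy0 : 0 < nrm (S y) by rewrite lt_def Sy nrm_ge0.
  rewrite -(ler_pM2r Sy0) -expr2 -rdotxx -TS.
  apply: le_trans (rdot_le_nrm _ _) _.
  by rewrite mulrAC ler_wpM2r ?nrm_ge0.
have [] := @xgetPex _ (0 : H -> H)
    [set S | bounded_op S /\ forall x y, hdot (T x) y = hdot x (S y)].
  by exists S; split=> // x y; exact: hdot_linear_eq.
by rewrite -/(adjoint T) => BT hT; split=> // x y; exact: hdot_rdot_eq.
Qed.

Lemma bounded_op_adjoint T : bounded_op T -> bounded_op (adjoint T).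
Proof. by case/adjoint_ex. Qed.

Lemma rdot_adjointr T x y : bounded_op T -> rdot x (adjoint T y) = rdot (T x) y.
Proof. by case/adjoint_ex => _ ->. Qed.

Lemma rdot_adjointl T x y : bounded_op T -> rdot (adjoint T x) y = rdot x (T y).
Proof. by move=> BT; rewrite rdotC rdot_adjointr // rdotC. Qed.

(** Over the complex numbers, a real quadratic form forces symmetry: the imaginary
    part of [<T z, z>] vanishes at [z = x + i y], and its cross terms are the
    difference of the two sides. *)
Lemma positive_opP T : bounded_op T ->
  positive_op T <->
  (forall x y, rdot (T x) y = rdot x (T y)) /\ forall x, 0 <= rdot (T x) x.
Proof.
move=> BT; have LT := BT.1; split=> [[_ T_ge0] | [Tsym T_ge0]]; last first.
  split=> // x; have im0 : rdot (T x) ('i *: x) = 0.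
    have := Tsym x ('i *: x); rewrite (linZ LT) -(rdot_i (T x) ('i *: x)).
    rewrite scalerA -expr2 sqr_i scaleN1r rdotNr (rdotC x).
    lra.
  by rewrite hdotE im0 lecE /= eqxx T_ge0.
have T0 x : 0 <= rdot (T x) x by have := T_ge0 x; rewrite hdotE lecE => /andP[].
split=> // x y.
have im0 z : rdot (T z) ('i *: z) = 0.
  by have := T_ge0 z; rewrite hdotE lecE /= => /andP[/eqP -> _].
have := im0 (x + 'i *: y); rewrite (linD LT) (linZ LT) scalerDr.
rewrite rdotDl !rdotDr im0 !rdot_i im0 scalerA -expr2 sqr_i scaleN1r rdotNr.
by rewrite (rdotC (T y)); lra.
Qed.

(** Uniqueness of the nearest point makes the choice of projections complex
    linear. *)
Lemma orthogonal_projector T : linear T -> closed (range T) ->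
  exists P, [/\ bounded_op P, forall x, range T (P x),
    forall s, range T s -> P s = s
    & forall x s, range T s -> rdot (x - P x) s = 0].
Proof.
move=> LT Tcl; have Tsub := linear_range_subspace LT.
have TZ a s : range T s -> range T (a *: s).
  by move=> [x _ <-]; exists (a *: x); rewrite // (linZ LT).
have TD x y : range T x -> range T y -> range T (x + y).
  by move=> [u _ <-] [v _ <-]; exists (u + v); rewrite // (linD LT).
have TB x y : range T x -> range T y -> range T (x - y).
  by move=> [u _ <-] [v _ <-]; exists (u - v); rewrite // (linB LT).
have /choice[P PP] x :
    exists p, range T p /\ forall s, range T s -> rdot (x - p) s = 0.
  by have [p /Tcl Tp pT] := orthogonal_projection x Tsub; exists p.
have PT x : range T (P x) by case: (PP x).
have Pperp x s : range T s -> rdot (x - P x) s = 0.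
  by case: (PP x) => _; exact.
have P_unique x p : range T p -> (forall s, range T s -> rdot (x - p) s = 0) ->
    P x = p.
  move=> Tp xp; apply/eqP; rewrite -subr_eq0; apply/eqP/rdotxx_eq0.
  have Td : range T (P x - p) by exact: TB.
  have {1}-> : P x - p = (x - p) - (x - P x) by rewrite opprB [RHS]addrC subrKA.
  by rewrite rdotBl xp // Pperp // subr0.
exists P; split=> //; last first.
  by move=> s Ts; apply: P_unique => // r _; rewrite subrr rdot0l.
apply/bounded_opP; split=> [a x y | ].
  apply: P_unique => [ | s Ts]; first by apply: TD => //; exact: TZ.
  rewrite opprD addrACA -scalerBr rdotDl Pperp // addr0.
  by rewrite rdotC rdot_conjZ rdotC Pperp //; exact: TZ.
exists 1 => // x; rewrite mul1r.
have [-> | Px] := eqVneq (nrm (P x)) 0; first exact: nrm_ge0.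
have Px0 : 0 < nrm (P x) by rewrite lt_def Px nrm_ge0.
rewrite -(ler_pM2r Px0) -expr2 -rdotxx.
apply: le_trans (rdot_le_nrm _ _).
by have := Pperp x (P x) (PT x); rewrite rdotBl => /eqP; rewrite subr_eq0 => /eqP ->.
Qed.

End Operators.

(** * The uniform boundedness principle *)

Section UniformBoundedness.
Variables (R : realType) (H : hilbertType R).

(** Sokal's gliding hump. From an unbounded sequence [y n] in [E] build
    [u (n+1) = u n + r n * (y n / |y n|)] or [u n - r n * (y n / |y n|)], where
    [r n = 3^-n], with the sign that makes [|<u (n+1), y n>|] at least
    [r n * |y n|]. The limit [l] of [u] lies within [r n / 2] of [u (n+1)], so that
    [|<l, y n>| >= r n * |y n| / 2], and this is unbounded if [y n] is chosen
    large enough. *)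
Lemma uniform_boundedness (E : set H) :
    (forall h, exists C, forall y, E y -> rdot h y <= C) ->
  exists C, forall y, E y -> nrm y <= C.
Proof.
move=> E_bd; apply: contrapT => E_unbd.
pose r (n : nat) : R := 3^-1 ^+ n.
have r0 n : 0 < r n by rewrite exprn_gt0.
have rS n : r n.+1 = r n / 3 by rewrite /r exprSr.
have r_le n : r n <= n.+1%:R^-1.
  rewrite /r exprVn lef_pV2 ?posrE ?exprn_gt0 //.
  by rewrite -natrX ler_nat; elim: n => // n IH; rewrite expnS; lia.
clearbody r.
have /choice[y yP] (n : nat) : exists y, E y /\ n%:R * 2 < r n * nrm y.
  apply: contrapT => /forallNP y_le; apply: E_unbd.
  exists (n%:R * 2 / r n) => y Ey; rewrite ler_pdivlMr // mulrC leNgt.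
  by apply/negP => ry; apply: (y_le y).
have Ey n : E (y n) by case: (yP n).
have y0 n : 0 < nrm (y n).
  have : 0 < r n * nrm (y n) by apply: le_lt_trans (yP n).2; rewrite mulr_ge0.
  by rewrite pmulr_rgt0.
pose s x n : R := if 0 <= rdot x (y n) then 1 else -1.
pose step n x := x + (s x n * (r n / nrm (y n)))%:C *: y n.
pose u n := iteri n step 0.
have s1 x n : `|s x n| = 1 by rewrite /s; case: ifP; rewrite ?normrN normr1.
have uS n : nrm (u n.+1 - u n) = r n.
  rewrite /u /= /step addrAC subrr add0r nrmZ normrM s1 mul1r ger0_norm.
    by rewrite divfK // gt_eqF.
  by rewrite divr_ge0 ?ltW.
have u_far n : r n * nrm (y n) <= `|rdot (u n.+1) (y n)|.
  rewrite /u /= /step -/(u n) rdotDl rdotZl rdotxx.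
  have -> : s (u n) n * (r n / nrm (y n)) * nrm (y n) ^+ 2
            = s (u n) n * (r n * nrm (y n)) 
    by rewrite expr2 -!mulrA mulKf // lt0r_neq0.
  have ry : 0 < r n * nrm (y n) by rewrite mulr_gt0.
  rewrite /s; case: ifP => [a0 | /negbT]; last rewrite -ltNge => a0.
    by rewrite mul1r ger0_norm; lra.
  by rewrite mulN1r ltr0_norm; lra.
clearbody u.
have u_near n k : nrm (u (n + k)%N - u n) <= 3 / 2 * (r n - r (n + k)%N).
  elim: k => [|k IH]; first by rewrite addn0 !subrr nrm0 mulr0.
  have := nrmD (u (n + k).+1 - u (n + k)%N) (u (n + k)%N - u n).
  by rewrite subrKA uS addnS rS; lra.
have u_tail n m : (n <= m)%N -> nrm (u m - u n) <= 3 / 2 * r n.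
  move=> nm; have := u_near n (m - n)%N; rewrite subnKC //.
  by have := r0 m; lra.
have [e e0 | l ul] := hilbert_complete (u := u).
  have [|N rN] := exists_natSinv_le (e := e / 3); first by rewrite divr_gt0.
  exists N => m n Nm Nn; have := nrmD (u m - u N) (u N - u n).
  rewrite subrKA (nrmBC (u N)) => /le_trans; apply.
  have := u_tail _ _ Nm; have := u_tail _ _ Nn.
  have := le_trans (r_le N) (rN _ (leqnn N)).
  by lra.
have l_near n : nrm (l - u n) <= 3 / 2 * r n.
  apply/ler_addgt0Pr => e /ul[N uN].
  have := nrmD (l - u (maxn N n)) (u (maxn N n) - u n); rewrite subrKA.
  have := uN _ (leq_maxl N n); have := u_tail _ _ (leq_maxr N n); lra.
have [C1 C1P] := E_bd l; have [C2 C2P] := E_bd (- l).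
have : `|C1| + `|C2| < (Num.truncn (`|C1| + `|C2|)).+1%:R by exact: truncnS_gt.
set n := (Num.truncn _).+1; apply/negP; rewrite -leNgt.
have := C1P _ (Ey n); have := C2P _ (Ey n); rewrite rdotNl.
have := u_far n; have := (yP n).2.
have lu : nrm (l - u n.+1) * nrm (y n) <= r n * nrm (y n) / 2.
  have := l_near n.+1; rewrite rS => ln.
  have -> : r n * nrm (y n) / 2 = r n / 2 * nrm (y n) by field.
  by rewrite ler_pM2r //; lra.
have := rdot_le_nrm (l - u n.+1) (y n); rewrite rdotBl => d1.
have := rdot_le_nrm (u n.+1 - l) (y n); rewrite rdotBl nrmBC => d2.
have := ler_norm C1; have := ler_norm C2.
have := normr_ge0 C1; have := normr_ge0 C2.
by case: (ler0P (rdot (u n.+1) (y n))) => u0; lra.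
Qed.

End UniformBoundedness.

(** * Factorization of bounded operators *)

Section Factorization.
Variables (R : realType) (H : hilbertType R).
Implicit Types (x y z h : H) (V : set H).

Lemma orthogonal_closure V x y :
  (forall v, V v -> rdot x v = 0) -> closure V y -> rdot x y = 0.
Proof.
move=> xV /closure_nrmP Vy.
suff xy_le0 z : nrm z = nrm x -> (forall v, V v -> rdot z v = 0) ->
    rdot z y <= 0.
  apply/eqP; rewrite eq_le xy_le0 //= -oppr_le0 -rdotNl xy_le0 ?nrmN // => v Vv.
  by rewrite rdotNl xV // oppr0.
move=> zx zV; apply/ler_addgt0Pr => e e0; rewrite add0r.
have x1 : 0 < 1 + nrm x by rewrite ltr_pwDl // nrm_ge0.
have [|v Vv yv] := Vy (e / (1 + nrm x)); first by rewrite divr_gt0.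
rewrite -[rdot z y]subr0 -(zV _ Vv) -rdotBr.
apply: le_trans (rdot_le_nrm _ _) _.
apply: (@le_trans _ _ ((1 + nrm x) * nrm (y - v))).
  by rewrite ler_wpM2r ?nrm_ge0 // zx lerDr.
by rewrite mulrC -ler_pdivlMr.
Qed.

(** Douglas' factorization theorem. [X h] is the solution of [A x = Q h] orthogonal
    to the kernel of [A]. Since [<X h, A^* y> = <h, Q^* y>], the vectors [Q^* y]
    with [|A^* y| <= 1] form a weakly bounded set, so they are bounded, say by [C];
    hence [<X h, v> <= C |h| |v|] for [v] in the range of [A^*]. That range is
    dense in the complement of the kernel of [A], so one may let [v] tend to
    [X h]. *)
Lemma bounded_op_factor (A Q : H -> H) :
    bounded_op A -> bounded_op Q -> range Q `<=` range A ->
  exists2 X, bounded_op X & A \o X = Q.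
Proof.
move=> BA BQ QA; have LA := BA.1; have LQ := BQ.1.
have [BA' BQ'] := (bounded_op_adjoint BA, bounded_op_adjoint BQ).
pose K : set H := [set x | A x = 0].
have Ksub : real_subspace K.
  split=> [|x y t]; first exact: lin0.
  by rewrite /K /= (linD LA) (linZ LA) => -> ->; rewrite scaler0 addr0.
have Kcl p : closure K p -> A p = 0.
  move=> Kp; apply: rdotxx_eq0; rewrite -rdot_adjointr // rdotC.
  apply: orthogonal_closure Kp => v Kv.
  by rewrite rdotC rdot_adjointr // Kv rdot0l.
have /choice[X XP] h : exists x, A x = Q h /\ forall k, K k -> rdot x k = 0.
  have [|x1 _ Ax1] := QA (Q h); first by exists h.
  have [p /Kcl Ap pK] := orthogonal_projection x1 Ksub.
  by exists (x1 - p); split=> //; rewrite (linB LA) Ap subr0.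
have AX h : A (X h) = Q h by case: (XP h).
have XK h k : K k -> rdot (X h) k = 0 by case: (XP h) => _; apply.
have LX : linear X.
  move=> a x y; apply/eqP; rewrite -subr_eq0; apply/eqP/rdotxx_eq0.
  set d := X _ - _.
  have Kd : K d by rewrite /K /= (linB LA) (linD LA) (linZ LA) !AX LQ subrr.
  rewrite {1}/d rdotBl rdotDl !XK // rdotC rdot_conjZ rdotC XK ?addr0 ?subr0 //.
  by rewrite /K /= (linZ LA) Kd scaler0.
have [C0 C0P] : exists C, forall v,
    [set adjoint Q y | y in [set y | nrm (adjoint A y) <= 1]] v -> nrm v <= C.
  apply: uniform_boundedness => h; exists (nrm (X h)) => _ [y Ay1 <-].
  rewrite rdot_adjointr // -AX -rdot_adjointr //.
  apply: le_trans (rdot_le_nrm _ _) _.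
  by rewrite -[leRHS]mulr1 ler_wpM2l ?nrm_ge0.
pose C := Num.max 0 C0; have C_ge0 : 0 <= C by rewrite le_max lexx.
have Xy h y : rdot (X h) (adjoint A y) <= C * nrm h * nrm (adjoint A y).
  have [/nrm_eq0 -> | Ay] := eqVneq (nrm (adjoint A y)) 0.
    by rewrite rdot0r nrm0 mulr0.
  have Ay0 : 0 < nrm (adjoint A y) by rewrite lt_def Ay nrm_ge0.
  rewrite -ler_pdivrMr // mulrC -rdotZr -(linZ BA'.1).
  rewrite rdot_adjointr // AX -rdot_adjointr // mulrC.
  apply: le_trans (rdot_le_nrm _ _) _.
  rewrite ler_wpM2l ?nrm_ge0 // le_max; apply/orP; right; apply: C0P.
  exists ((nrm (adjoint A y))^-1%:C *: y) => //=.
  by rewrite (linZ BA'.1) nrmZ ger0_norm ?invr_ge0 ?nrm_ge0 // mulVf.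
have Xcl h : closure (range (adjoint A)) (X h).
  have [p clp pA] :=
    orthogonal_projection (X h) (linear_range_subspace BA'.1).
  suff /eqP : X h - p = 0 by rewrite subr_eq0 => /eqP ->.
  have Kd : K (X h - p).
    by apply: rdot_inj => y; rewrite rdot0r rdotC -rdot_adjointr // pA //;
      exists y.
  apply: rdotxx_eq0; rewrite rdotBr (orthogonal_closure pA clp) subr0 rdotC.
  exact: XK.
exists X; last by apply/funext => h; exact: AX.
apply/bounded_opP; split=> //; exists C => // h.
have [-> | Xh] := eqVneq (nrm (X h)) 0; first by rewrite mulr_ge0 ?nrm_ge0.
have Xh0 : 0 < nrm (X h) by rewrite lt_def Xh nrm_ge0.
rewrite -(ler_pM2r Xh0); apply/ler_addgt0Pr => e e0.
pose s := nrm (X h) + C * nrm h.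
have s0 : 0 < s by rewrite ltr_pwDl // mulr_ge0 ?nrm_ge0.
have /closure_nrmP/(_ (e / s))[|_ [y _ <-] yX] := Xcl h.
  by rewrite divr_gt0.
rewrite -expr2 -rdotxx.
have -> : rdot (X h) (X h) =
    rdot (X h) (X h - adjoint A y) + rdot (X h) (adjoint A y).
  by rewrite rdotBr subrK.
have ye : s * nrm (X h - adjoint A y) <= e by rewrite mulrC -ler_pdivlMr.
have Ch0 : 0 <= C * nrm h by rewrite mulr_ge0 ?nrm_ge0.
have := rdot_le_nrm (X h) (X h - adjoint A y).
have := nrmB (adjoint A y) (X h); rewrite nrmBC => AyX.
have := ler_wpM2l Ch0 AyX; have := Xy h y.
by rewrite /s in ye; lra.
Qed.

End Factorization.

(** * Weighted least squares *)

Section WeightedLeastSquares.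
Variables (R : realType) (H : hilbertType R).
Implicit Types (x y z s v : H) (S T X Z : H -> H).

Variables A W : H -> H.
Hypothesis BA : bounded_op A.
Hypothesis W_ge0 : positive_op W.

Let LA : linear A := BA.1.
Let LW : linear W := W_ge0.1.1.

Lemma weight_sym x y : rdot (W x) y = rdot x (W y).
Proof. by have /(positive_opP W_ge0.1)[-> _] := W_ge0. Qed.

Lemma weight_ge0 x : 0 <= rdot (W x) x.
Proof. by have /(positive_opP W_ge0.1)[_] := W_ge0; exact. Qed.

Lemma weight_quadD x y :
  rdot (W (x + y)) (x + y)
  = rdot (W x) x + rdot (W x) y *+ 2 + rdot (W y) y.
Proof.
rewrite (linD LW) rdotDl !rdotDr (weight_sym y x) (rdotC y (W x)).
ring.
Qed.

Lemma bounded_residual X : bounded_op X -> bounded_op (A \o X - id).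
Proof.
by move=> BX; apply: (bounded_opB _ (@bounded_op_id _ H)); exact: bounded_op_comp.
Qed.

Lemma bounded_residual_form X : bounded_op X -> bounded_op (residual_form A W X).
Proof.
move=> /bounded_residual BX; apply: bounded_op_comp => //.
apply: bounded_op_comp; last exact: W_ge0.1.
exact: bounded_op_adjoint.
Qed.

Lemma rdot_residual_form X x y : bounded_op X ->
  rdot (residual_form A W X x) y = rdot (W (A (X x) - x)) (A (X y) - y).
Proof. by move=> /bounded_residual BX; rewrite rdot_adjointl. Qed.

Lemma residual_form_sym X x y : bounded_op X ->
  rdot (residual_form A W X x) y = rdot x (residual_form A W X y).
Proof.
move=> BX; rewrite [RHS]rdotC !rdot_residual_form // weight_sym.
exact: rdotC.
Qed.

Lemma op_leP S T : bounded_op S -> bounded_op T ->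
    (forall x y, rdot (S x) y = rdot x (S y)) ->
    (forall x y, rdot (T x) y = rdot x (T y)) ->
  op_le S T <-> forall x, rdot (S x) x <= rdot (T x) x.
Proof.
move=> BS BT Ssym Tsym; rewrite /op_le positive_opP; last exact: bounded_opB.
split=> [[_ TS] x | ST]; first by rewrite -subr_ge0 -rdotBl; exact: TS.
split=> [x y | x]; first by rewrite !fctE rdotBl rdotBr Ssym Tsym.
by rewrite !fctE rdotBl subr_ge0.
Qed.

(** The normal equations of the weighted least squares problem, for a residual
    [v]. *)
Definition weight_orthogonal v := forall s, range A s -> rdot (W v) s = 0.

Lemma weight_orthogonal_min v s : weight_orthogonal v -> range A s ->
  rdot (W v) v <= rdot (W (v + s)) (v + s).
Proof.
move=> vA As; rewrite weight_quadD (vA s As) mul0rn addr0 lerDl.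
exact: weight_ge0.
Qed.

Lemma residual_form_le X0 X :
    bounded_op X0 -> bounded_op X -> (forall x, weight_orthogonal (A (X0 x) - x)) ->
  op_le (residual_form A W X0) (residual_form A W X).
Proof.
move=> BX0 BX X0A; apply/op_leP; try exact: bounded_residual_form.
- by move=> x y; exact: residual_form_sym.
- by move=> x y; exact: residual_form_sym.
move=> x; rewrite !rdot_residual_form //.
have -> : A (X x) - x = A (X0 x) - x + A (X x - X0 x).
  by rewrite (linB LA) [RHS]addrC subrKA.
by apply: weight_orthogonal_min => //; exists (X x - X0 x).
Qed.

(** The factor [X0] of the compatible projection [Q] through [A] solves the normal
    equations at every vector. *)
Lemma compatible_is_op_min : compatible W (range A) ->
  exists X0, [/\ bounded_op X0,
    is_op_min (residual_form A W @` @bounded_op R H) (residual_form A W X0)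
    & is_shorted W (range A) (residual_form A W X0)].
Proof.
move=> [Q [BQ QQ QA WQ]].
have [X0 BX0 AX0] : exists2 X, bounded_op X & A \o X = Q.
  by apply: bounded_op_factor => //; rewrite QA.
have AX0E x : A (X0 x) = Q x by rewrite -AX0.
have Qs s : range A s -> Q s = s.
  by rewrite -QA => -[x _ <-]; exact: (congr1 (@^~ x) QQ).
have rA x : range A (Q x) by rewrite -QA; exists x.
have X0A x : weight_orthogonal (A (X0 x) - x).
  move=> s As; rewrite AX0E -(Qs _ As) -rdot_adjointl //.
  rewrite -[adjoint Q _]/((adjoint Q \o W) _) -WQ /=.
  by rewrite (linB BQ.1) Qs // subrr (lin0 LW) rdot0l.
have BF := bounded_residual_form BX0.
have Fsym x y := residual_form_sym x y BX0.
exists X0; split=> //.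
  split; first by exists X0.
  by move=> _ [X BX <-]; exact: residual_form_le.
have B0 : bounded_op (0 : H -> H).
  by rewrite -(subrr id); apply: bounded_opB; exact: bounded_op_id.
split.
  split=> //.
  - apply/op_leP => // [x y | x]; first by rewrite rdot0l rdot0r.
    by rewrite rdot0l rdot_residual_form //; exact: weight_ge0.
  (* [W] is the residual form of [X = 0], whose residual at [x] is [- x]. *)
  - apply/op_leP => //; [exact: W_ge0.1 | exact: weight_sym | move=> x].
    rewrite rdot_residual_form //.
    have -> : rdot (W x) x = rdot (W (- x)) (- x).
      by rewrite (linN LW) rdotNl rdotNr opprK.
    have As : range A (A (- X0 x)) by exists (- X0 x).
    have := weight_orthogonal_min (X0A x) As.
    by rewrite (linN LA) addrAC subrr add0r.
  - move=> _ [x _ <-] s As.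
    have F_orth r : range A r -> rdot r (residual_form A W X0 x) = 0.
      move=> Ar; rewrite rdotC rdot_residual_form // weight_sym rdotC.
      by rewrite AX0E Qs // subrr (lin0 LW) rdot0l.
    rewrite hdotE F_orth // rdot_conjZ F_orth //.
    by case: As => y _ <-; exists ('i^*%C *: y); rewrite // (linZ LA).
move=> Z [BZ Z_ge0 ZW ZA]; apply/op_leP => //.
  by have [] := (positive_opP BZ).1; rewrite // -[Z]subr0.
move=> x.
have Zsym y z : rdot (Z y) z = rdot y (Z z).
  by have [] := (positive_opP BZ).1; rewrite // -[Z]subr0.
have Zorth y s : range A s -> rdot (Z y) s = 0.
  move=> As; rewrite rdotC -[RHS](rdot0r s); apply: hdot_rdot_eq.
  by rewrite linear0r; apply: ZA => //; exists y.
(* [Z] vanishes on the range of [A] on both sides, so its quadratic form does not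
   see the component of the residual there. *)
have -> : rdot (Z x) x = rdot (Z (A (X0 x) - x)) (A (X0 x) - x).
  have As : range A (A (X0 x)) by exists (X0 x).
  rewrite rdotBr (Zorth _ _ As) sub0r (linB BZ.1) rdotBl opprB.
  by rewrite (Zsym (A _)) (rdotC (A _)) (Zorth _ _ As) subr0.
rewrite rdot_residual_form //.
have ZWP : op_le Z W <-> forall x, rdot (Z x) x <= rdot (W x) x.
  by apply: op_leP => //; [exact: W_ge0.1 | exact: weight_sym].
exact: (ZWP.1 ZW).
Qed.

(** Perturbing [X0] by the multiples of the identity is enough: the first order
    condition says that [T = A^* W (A X0 - I)] has zero quadratic form, and a
    complex operator with this property is zero. *)
Lemma op_min_weight_orthogonal X0 : bounded_op X0 ->
    is_op_min (residual_form A W @` @bounded_op R H) (residual_form A W X0) ->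
  forall x, weight_orthogonal (A (X0 x) - x).
Proof.
move=> BX0 [_ X0min].
have le_X0 X : bounded_op X -> forall x,
    rdot (W (A (X0 x) - x)) (A (X0 x) - x) <= rdot (W (A (X x) - x)) (A (X x) - x).
  move=> BX x; rewrite -!rdot_residual_form //.
  have FP : op_le (residual_form A W X0) (residual_form A W X) <->
      forall x, rdot (residual_form A W X0 x) x <= rdot (residual_form A W X x) x.
    apply: op_leP; try exact: bounded_residual_form.
      by move=> y z; exact: residual_form_sym.
    by move=> y z; exact: residual_form_sym.
  by apply: FP.1; apply: X0min; exists X.
pose T := adjoint A \o (W \o (A \o X0 - id)).
have BT : bounded_op T.
  apply: bounded_op_comp; first exact: bounded_op_adjoint.
  by apply: bounded_op_comp; [exact: W_ge0.1 | exact: bounded_residual].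
have Tx x z : rdot (T x) z = rdot (W (A (X0 x) - x)) (A z).
  by rewrite rdot_adjointl.
have T0 (a : R[i]) x : rdot (T x) (a *: x) = 0.
  rewrite Tx; pose q := rdot (W (A (a *: x))) (A (a *: x)).
  apply: (@quadratic_ge0_linear_eq0 _ q) => t; rewrite /q.
  have BX : bounded_op (X0 - (fun h => (- (t%:C * a)) *: h)).
    by apply: bounded_opB => //; exact: bounded_opZ.
  have := le_X0 _ BX x; rewrite !fctE.
  have -> : A (X0 x - (- (t%:C * a)) *: x) - x
            = A (X0 x) - x + t%:C *: A (a *: x).
    by rewrite scaleNr opprK (linD LA) -scalerA (linZ LA t%:C) addrAC.
  rewrite (weight_quadD (_ - _) (_ *: _)) rdotZr (linZ LW) rdotZl rdotZr; lra.
(* A zero form is positive, so [T] is symmetric and real polarization applies. *)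
have T_ge0 : positive_op T.
  by split=> // x; rewrite hdotE T0 -[X in rdot _ X]scale1r T0.
have Tsym x y : rdot (T x) y = rdot x (T y).
  by have /(positive_opP BT)[-> _] := T_ge0.
move=> x _ [z _ <-]; rewrite -Tx.
have := T0 1 (x + z); rewrite scale1r (linD BT.1) rdotDl !rdotDr.
have := T0 1 x; have := T0 1 z; rewrite !scale1r => -> ->.
by rewrite (Tsym z) (rdotC z); lra.
Qed.

(** [A X0] solves the normal equations but need not be idempotent, because it may
    differ from the identity on the range of [A] by vectors that [W] does not see.
    Using [A X0] only on the orthogonal complement of the range repairs this. *)
Lemma op_min_compatible X0 : closed (range A) -> bounded_op X0 ->
    is_op_min (residual_form A W @` @bounded_op R H) (residual_form A W X0) ->
  compatible W (range A).
Proof.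
move=> clA BX0 /(op_min_weight_orthogonal BX0) X0A.
have [P [BP PA Ps _]] := orthogonal_projector LA clA.
have BAX := bounded_op_comp BA BX0.
pose Q := A \o X0 - (A \o X0 \o P - P).
have BQ : bounded_op Q.
  by apply: bounded_opB => //; apply: bounded_opB => //; exact: bounded_op_comp.
have QE x : Q x = A (X0 x) - (A (X0 (P x)) - P x) by [].
have Qs s : range A s -> Q s = s.
  by move=> As; rewrite QE Ps // subKr.
have QA x : range A (Q x).
  rewrite QE; have [z _ <-] := PA x.
  by exists (X0 x - (X0 (A z) - z)); rewrite // !(linB LA).
(* [Q x - x] is the difference of the residuals at [x] and at [P x]. *)
have WQ x s : range A s -> rdot (W (Q x)) s = rdot (W x) s.
  move=> As; apply/eqP; rewrite -subr_eq0 -rdotBl -(linB LW) QE.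
  by rewrite addrAC (linB LW) rdotBl !X0A // subrr.
exists Q; split=> //.
- by apply/funext => x /=; exact: Qs.
- by apply/seteqP; split=> [_ [x _ <-] // | s As]; exists s => //; exact: Qs.
apply/funext => x; apply: rdot_inj => y /=.
rewrite rdot_adjointr // (rdotC (Q y)) -WQ // -(weight_sym y).
by rewrite -(WQ y) // weight_sym rdotC.
Qed.

End WeightedLeastSquares.

Local Close Scope complex_scope.

Theorem theorem3p2 (R : realType) (H : hilbertType R) (A W : H -> H)
    (sepH : separable H) (LA : bounded_op A) (clA : closed (range A))
    (W_ge0 : positive_op W) :
  ((exists X0 : H -> H, bounded_op X0 /\
      is_op_min (residual_form A W @` @bounded_op R H) (residual_form A W X0))
   <-> compatible W (range A))
  /\
  ((exists X0 : H -> H, [/\ bounded_op X0,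
      is_op_min (residual_form A W @` @bounded_op R H) (residual_form A W X0)
      & is_shorted W (range A) (residual_form A W X0)])
   <-> compatible W (range A)).
Proof.
have min_compatible X0 : bounded_op X0 ->
    is_op_min (residual_form A W @` @bounded_op R H) (residual_form A W X0) ->
  compatible W (range A) by exact: op_min_compatible.
have compatible_min := compatible_is_op_min LA W_ge0.
split; split=> [[X0 []] | /compatible_min[X0 []]].
- exact: min_compatible.
- by exists X0.
- by move=> BX0 /(min_compatible _ BX0).
- by exists X0.
Qed.
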